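(* Let $X$ be an infinite densely totally ordered set such that any two nonempty convex subsets of $X$ having no minimum and no maximum are order-isomorphic. Suppose that $X$ has a minimum and a maximum. Then $\operatorname{rank}(\mathcal{OP}(X):\mathcal{O}(X)) = 1$.
   Context: Let $(X,\le)$ be a totally ordered set. The order is dense if for all $x<y$ in $X$ there is $z\in X$ with $x<z<y$. A subset $C\subseteq X$ is convex if $x,y\in C$, $z\in X$ and $x<z<y$ imply $z\in C$. Two subchains are order-isomorphic if there is an order-preserving bijection between them. $\mathcal{T}(X)$ is the monoid of all maps $X\to X$ under composition; maps are written on the right, so $x(\alpha\beta)=(x\alpha)\beta$. A map $f$ from a subchain of $X$ into $X$ is order-preserving if $x\le y$ implies $xf\le yf$. $\mathcal{O}(X)$ is the submonoid of all order-preserving $\alpha\in\mathcal{T}(X)$. A transformation $\alpha\in\mathcal{T}(X)$ is orientation-preserving if there is a nonempty subset $X_1\subseteq X$ such that, with $X_2=X\setminus X_1$ (possibly empty): (1) $\alpha$ is order-preserving on $X_1$ and on $X_2$; (2) for all $p\in X_1$ and $q\in X_2$ we have $p<q$ and $p\alpha\ge q\alpha$. $\mathcal{OP}(X)$ is the semigroup of all orientation-preserving transformations of $X$; it contains $\mathcal{O}(X)$. For a semigroup $S$ and a subset $A\subseteq S$, the relative rank $\operatorname{rank}(S:A)$ is the minimal cardinality of a set $B\subseteq S$ such that $A\cup B$ generates $S$. *)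

(* Defs.v *)
From HB Require Import structures.
From mathcomp Require Import all_boot all_order.
From mathcomp Require Import boolp classical_sets functions cardinality.

Set Implicit Arguments.
Unset Strict Implicit.
Unset Printing Implicit Defensive.

Import Order.TTheory.
Local Open Scope order_scope.
Local Open Scope classical_set_scope.
Local Open Scope card_scope.

Section Chains.
Context {d : Order.disp_t} {X : orderType d}.
Implicit Types C D : set X.

Definition densely_ordered (Y : orderType d) : Prop :=
  forall x y : Y, x < y -> exists2 z, x < z & z < y.

Definition convex C : Prop :=
  forall x y z, C x -> C y -> x < z -> z < y -> C z.

Definition has_minimum C : Prop := exists2 m, C m & lbound C m.

Definition has_maximum C : Prop := exists2 m, C m & ubound C m.

Definition order_preserving_on C (f : X -> X) : Prop :=
  forall x y, C x -> C y -> x <= y -> f x <= f y.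

(* The isomorphism is given by a total map on X, only its values on C matter. *)
Definition order_isomorphic C D : Prop :=
  exists2 f : X -> X, set_bij C D f & order_preserving_on C f.

End Chains.

Definition transf (X : Type) : Type := X -> X.

HB.instance Definition _ (X : Type) := gen_eqMixin (transf X).
HB.instance Definition _ (X : Type) := gen_choiceMixin (transf X).

Section TransfMonoid.
Variable X : Type.

(* Maps act on the right: in a product the left factor is applied first. *)
Definition transf_mul (a b : transf X) : transf X := fun x => b (a x).
Definition transf_one : transf X := fun x => x.

Fact transf_mulA : associative transf_mul. Proof. by []. Qed.
Fact transf_mul1 : left_id transf_one transf_mul. Proof. by []. Qed.
Fact transf_mulr1 : right_id transf_one transf_mul. Proof. by []. Qed.

HB.instance Definition _ :=
  isMonoid.Build (transf X) transf_mulA transf_mul1 transf_mulr1.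

End TransfMonoid.

Definition order_preserving {d : Order.disp_t} (X : orderType d) :
  set (transf X) := [set a | order_preserving_on [set: X] a].

Definition orientation_preserving {d : Order.disp_t} (X : orderType d) :
  set (transf X) :=
  [set a | exists X1 : set X,
     [/\ X1 !=set0,
         order_preserving_on X1 a,
         order_preserving_on (~` X1) a
       & forall p q, X1 p -> (~` X1) q -> p < q /\ a q <= a p]].

Arguments order_preserving {d} X.
Arguments orientation_preserving {d} X.

Section RelativeRank.
Context {M : semigroupType}.
Implicit Types S A B G : set M.

Definition mul_closed G : Prop :=
  forall a b, G a -> G b -> G (a * b)%g.

Definition generated_subsemigroup A : set M := smallest mul_closed A.

(* The subsemigroup S of M is given as a subset of M. The cardinal is
   represented by a set K of that cardinality, so that infinite values of the
   relative rank are covered. *)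
Definition relative_rank_is S A {U : Type} (K : set U) : Prop :=
  (exists B, [/\ B `<=` S, generated_subsemigroup (A `|` B) = S & B #= K]) /\
  (forall B, B `<=` S -> generated_subsemigroup (A `|` B) = S -> K #<= B).

End RelativeRank.

(* Main.v *)
Require Import Defs.
From mathcomp Require Import all_boot all_order.
From mathcomp Require Import boolp classical_sets functions cardinality.

(** Let m and M be the extremal points of X, and let c' < c. Homogeneity makes
    X order-isomorphic to [m, c'] and to [c, M], by embeddings e1, e2 with
    order-preserving retractions r1, r2. Let gamma exchange these two copies of
    X. If alpha is orientation-preserving with cut X1 | X2, then
    alpha = beta * gamma * delta where beta embeds X1 in the first copy and X2
    in the second one (leaving a hole at the cut), so that beta * gamma has X2
    below X1 in separate copies of X, and the order-preserving delta applies
    alpha on each of these copies. *)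

Import Order.TTheory.
Local Open Scope order_scope.
Local Open Scope card_scope.
Local Open Scope classical_set_scope.

Section Chain.
Context {d : Order.disp_t} {X : orderType d}.
Implicit Types (a b : transf X) (u v x y : X).

Lemma order_preserving_orientation_preserving a :
  nonempty [set: X] -> order_preserving X a -> orientation_preserving X a.
Proof.
move=> X0 opa; exists setT; split=> //.
by move=> x y [].
Qed.

Lemma order_preserving_mul_closed : mul_closed (order_preserving X).
Proof. by move=> a b opa opb x y _ _ xy; apply: opb => //; apply: opa. Qed.

(** Both [X1] and [Y1] are initial segments. If [a] sends some point of [X1] into [Y1], then it
    sends all of the complement of [X1] there, as values beyond the cut are lower; the cut of the
    product then falls within [X1] or at its end. Otherwise [a] sends [X1] outside [Y1], and the new
    initial segment extends [X1]. *)
Lemma orientation_preserving_mul_closed :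
  mul_closed (orientation_preserving X).
Proof.
move=> a b [X1 [[x0 X1x0] a1 a2 aX]] [Y1 [[y0 Y1y0] b1 b2 bY]].
have Ydown x y : x <= y -> Y1 y -> Y1 x.
  by move=> xy Yy; apply: contrapT => /(bY _ _ Yy)[]; rewrite ltNge xy.
have Xdown x y : x <= y -> X1 y -> X1 x.
  by move=> xy Xy; apply: contrapT => /(aX _ _ Xy)[]; rewrite ltNge xy.
have [[p [X1p Y1p]]|noY1] := pselect (exists p, X1 p /\ Y1 (a p)).
- have X2Y1 q : ~ X1 q -> Y1 (a q).
    by move=> X2q; apply: Ydown Y1p; have [] := aX _ _ X1p X2q.
  exists [set x | X1 x /\ Y1 (a x)]; split; first by exists p.
  + by move=> x y [Xx Yx] [Xy Yy] xy; apply: b1 => //; apply: a1.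
  + move=> x y /= nx ny xy.
    have [Xx|Xx] := pselect (X1 x).
      have nYx : ~ Y1 (a x) by move=> Yx; apply: nx.
      have [Xy|Xy] := pselect (X1 y).
        have nYy : ~ Y1 (a y) by move=> Yy; apply: ny.
        by apply: b2 => //; apply: a1.
      by have [] := bY _ _ (X2Y1 _ Xy) nYx.
    have Xy : ~ X1 y by move=> Xy; apply: Xx; apply: Xdown Xy.
    by apply: b1; [exact: X2Y1|exact: X2Y1|exact: a2].
  + move=> x y [Xx Yx] /= ny; have [Xy|Xy] := pselect (X1 y).
      have nYy : ~ Y1 (a y) by move=> Yy; apply: ny.
      have [lt_a le_b] := bY _ _ Yx nYy; split=> //.
      rewrite ltNge; apply: contraPN lt_a => /(a1 _ _ Xy Xx).
      by rewrite leNgt => /negP.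
    have [xy le_a] := aX _ _ Xx Xy; split=> //.
    by apply: b1 => //; exact: X2Y1.
- have X1Y2 x : X1 x -> ~ Y1 (a x) by move=> Xx Yx; apply: noY1; exists x.
  exists [set x | X1 x \/ Y1 (a x)]; split; first by exists x0; left.
  + move=> x y /= Zx Zy xy.
    have [Xx|Xx] := pselect (X1 x); have [Xy|Xy] := pselect (X1 y).
    * by apply: b2; [exact: X1Y2|exact: X1Y2|exact: a1].
    * by case: Zy => // Yy; have [] := bY _ _ Yy (X1Y2 _ Xx).
    * by case: Xx; apply: Xdown Xy.
    * by case: Zx => // Yx; case: Zy => // Yy; apply: b1 => //; apply: a2.
  + move=> x y /= /not_orP[Xx Yx] /not_orP[Xy Yy] xy.
    by apply: b2 => //; apply: a2.
  + move=> x y /= Zx /not_orP[Xy Yy].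
    have [Xx|Xx] := pselect (X1 x).
      have [xy le_a] := aX _ _ Xx Xy; split=> //.
      by apply: b2 => //; exact: X1Y2.
    case: Zx => // Yx; have [lt_a le_b] := bY _ _ Yx Yy; split=> //.
    rewrite ltNge; apply: contraPN lt_a => /(a2 _ _ Xy Xx).
    by rewrite leNgt => /negP.
Qed.

Section Homogeneous.
Hypothesis denseX : densely_ordered X.
Hypothesis isoX : forall C D : set X,
  C !=set0 -> convex C -> ~ has_minimum C -> ~ has_maximum C ->
  D !=set0 -> convex D -> ~ has_minimum D -> ~ has_maximum D ->
  order_isomorphic C D.
Variables m M : X.
Hypothesis min_m : forall x, m <= x.
Hypothesis max_M : forall x, x <= M.

Let open_interval u v : set X := [set x | u < x < v].

Let open_interval_open u v : u < v ->
  [/\ open_interval u v !=set0, convex (open_interval u v),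
      ~ has_minimum (open_interval u v) & ~ has_maximum (open_interval u v)].
Proof.
move=> uv; split.
- by have [z uz zv] := denseX _ _ uv; exists z; apply/andP.
- move=> x y z /andP[ux _] /andP[_ yv] xz zy.
  by apply/andP; split; [exact: lt_trans xz|exact: lt_trans yv].
- move=> [x /andP[ux xv] lbx]; have [z uz zx] := denseX _ _ ux.
  have /lbx : open_interval u v z by apply/andP; split=> //; exact: lt_trans xv.
  by rewrite leNgt zx.
- move=> [x /andP[ux xv] ubx]; have [z xz zv] := denseX _ _ xv.
  have /ubx : open_interval u v z by apply/andP; split=> //; exact: lt_trans xz.
  by rewrite leNgt xz.
Qed.

(** Homogeneity only compares sets without extremal points, so an isomorphism of the open intervals
    is extended by sending [m] to [u] and [M] to [v]. *)
Lemma closed_interval_retract u v : u < v ->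
  exists e r : transf X, [/\ order_preserving X e, order_preserving X r,
    forall x, r (e x) = x & forall x, u <= e x <= v].
Proof.
move=> uv; have mM : m < M.
  exact: le_lt_trans (min_m u) (lt_le_trans uv (max_M v)).
have [C0 Cc Cm CM] := open_interval_open _ _ mM.
have [D0 Dc Dm DM] := open_interval_open _ _ uv.
have [f [fD finj fsurj] fop] := isoX _ _ C0 Cc Cm CM D0 Dc Dm DM.
have inC x : x != m -> x != M -> open_interval m M x.
  by move=> xm xM; apply/andP; rewrite !lt_neqAle min_m max_M eq_sym xm xM.
have fuv x : open_interval m M x -> u < f x < v.
  exact: fD.
pose e : transf X := fun x => if x == m then u else if x == M then v else f x.
have eM : e M = v by rewrite /e eq_sym (lt_eqF mM) eqxx.
have euv x : u <= e x <= v.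
  rewrite /e; case: ifPn => [_|xm]; first by rewrite lexx ltW.
  case: ifPn => [_|xM]; first by rewrite lexx ltW.
  by have /andP[ux xv] := fuv _ (inC _ xm xM); rewrite !ltW.
have elt x y : x < y -> e x < e y.
  move=> xy.
  have ym : y != m by rewrite gt_eqF// (le_lt_trans (min_m x)).
  have xM : x != M by rewrite lt_eqF// (lt_le_trans xy).
  rewrite /e (negbTE ym) (negbTE xM).
  case: ifPn => [_|xm]; case: ifPn => [//|yM].
  - by have /andP[] := fuv _ (inC _ ym yM).
  - by have /andP[] := fuv _ (inC _ xm xM).
  have Cx := inC _ xm xM; have Cy := inC _ ym yM.
  rewrite lt_neqAle fop ?(ltW xy)// andbT.
  apply/eqP => fxy; move: xy; rewrite (finj x y) ?ltxx//; exact/mem_set.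
have ele x y : (e x <= e y) = (x <= y).
  have [xy|yx|->] := ltgtP x y; last exact: lexx.
    by rewrite ltW// elt.
  by rewrite leNgt elt.
(* The bounds stand under the existential so that [choice] yields a total inverse; outside the
   interval [m] is a dummy value. *)
have esurj y : exists x, u <= y <= v -> e x = y.
  have [/andP[uy yv]|_] := boolP (u <= y <= v); last by exists m.
  have [->|yu] := eqVneq y u; first by exists m; rewrite /e eqxx.
  have [->|yv'] := eqVneq y v; first by exists M.
  have /fsurj[x Cx <-] : open_interval u v y.
    by apply/andP; rewrite !lt_neqAle uy yv yv' eq_sym yu.
  exists x => _; move: Cx => /andP[mx xM].
  by rewrite /e (gt_eqF mx) (lt_eqF xM).
have [g eg] := choice esurj.
(* Clamping to the interval before inverting [e] makes the retraction monotone on all of [X]. *)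
exists e, (fun y => g (Order.max u (Order.min y v))).
have clampuv y : u <= Order.max u (Order.min y v) <= v.
  by rewrite le_max lexx ge_max (ltW uv) ge_min lexx orbT.
split=> //.
- by move=> x y _ _; rewrite ele.
- move=> x y _ _ xy; rewrite -ele !eg//.
  by rewrite le_max2// le_min2.
- move=> x; have /andP[ux xv] := euv x.
  have -> : Order.max u (Order.min (e x) v) = e x.
    by rewrite min_l// max_r.
  by apply/le_anti; rewrite -(ele _ x) -(ele x) eg ?ux// lexx.
Qed.

(** The map [c] is chosen before [a], so this one map suffices as a generator. *)
Lemma orientation_preserving_factor : m < M ->
  exists2 c : transf X, orientation_preserving X c &
  forall a, orientation_preserving X a -> exists b b' : transf X,
    [/\ order_preserving X b, order_preserving X b' & a = (b * c * b')%g].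
Proof.
(* Since [k'] lies strictly below [k], comparison with [k] tells the two copies of [X] apart. *)
move=> mM; have [k' mk' k'M] := denseX _ _ mM.
have [k k'k kM] := denseX _ _ k'M.
have [e1 [r1 [e1op r1op e1K e1uv]]] := closed_interval_retract _ _ mk'.
have [e2 [r2 [e2op r2op e2K e2uv]]] := closed_interval_retract _ _ kM.
have e1k x : e1 x < k by have /andP[_ h] := e1uv x; exact: le_lt_trans k'k.
have e2k x : (e2 x < k) = false.
  by have /andP[h _] := e2uv x; rewrite ltNge h.
have e12 x y : e1 x <= e2 y.
  by have /andP[h _] := e2uv y; rewrite ltW// (lt_le_trans (e1k x)).
exists (fun x => if x < k then e2 (r1 x) else e1 (r2 x)).
  exists [set x | x < k]; split.
  - by exists m; apply: lt_trans k'k.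
  - by move=> x y /= -> -> xy; apply: e2op => //; apply: r1op.
  - move=> x y /= /negP/negbTE-> /negP/negbTE-> xy.
    by apply: e1op => //; apply: r2op.
  - move=> p q /= pk /negP qk; rewrite pk (negbTE qk); split=> //.
    by rewrite -leNgt in qk; exact: lt_le_trans qk.
move=> a [X1 [_ a1 a2 aX]].
have Xdown x y : x <= y -> X1 y -> X1 x.
  by move=> xy Xy; apply: contrapT => /(aX _ _ Xy)[]; rewrite ltNge xy.
pose b : transf X := fun x => if x \in X1 then e1 x else e2 x.
(* After [b] and [c], the points from outside [X1] lie in the lower copy and those of [X1] in the
   upper one. On the rest of each copy a monotone filler is needed: [m] on the initial segment [X1],
   and [M] beyond it. *)
pose lo : transf X := fun x => if x \in X1 then m else a x.
pose hi : transf X := fun x => if x \in X1 then a x else M.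
exists b, (fun y => if y < k then lo (r1 y) else hi (r2 y)); split.
- move=> x y _ _ xy; rewrite /b.
  have [Xx|Xx] := boolP (x \in X1); have [Xy|Xy] := boolP (y \in X1) => //.
  + exact: e1op.
  + by case/negP: Xx; apply/mem_set/(Xdown _ _ xy)/set_mem.
  + exact: e2op.
- have loop x y : x <= y -> lo x <= lo y.
    rewrite /lo => xy.
    have [Xx//|Xx] := boolP (x \in X1); have [Xy|Xy] := boolP (y \in X1).
      by case/negP: Xx; apply/mem_set/(Xdown _ _ xy)/set_mem.
    by apply: a2 => //= /mem_set; exact/negP.
  have hiop x y : x <= y -> hi x <= hi y.
    rewrite /hi => xy.
    have [Xy|Xy//] := boolP (y \in X1); have [Xx|Xx] := boolP (x \in X1).
      by apply: a1 => //; exact: set_mem.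
    by case/negP: Xx; apply/mem_set/(Xdown _ _ xy)/set_mem.
  (* Monotonicity across the two copies is where the drop of [a] at the cut is used. *)
  have lohi x y : lo x <= hi y.
    rewrite /lo /hi; case: ifPn => //; rewrite notin_setE => Xx.
    by case: ifPn => // /set_mem Xy; have [] := aX _ _ Xy Xx.
  move=> x y _ _ xy /=; case: ltP => xk; case: ltP => yk //.
  + by apply: loop; apply: r1op.
  + by have := lt_le_trans yk (le_trans xk xy); rewrite ltxx.
  + by apply: hiop; apply: r2op.
- apply/funext => x; rewrite /mul /= /transf_mul /b.
  have [Xx|Xx] := boolP (x \in X1).
    by rewrite e1k e1K e2k e2K /hi Xx.
  by rewrite e2k e2K e1k e1K /lo (negbTE Xx).
Qed.

(** This excludes relative rank 0. The witness has its cut just after [m]. *)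
Lemma orientation_preserving_not_order_preserving : m < M ->
  exists2 a : transf X, orientation_preserving X a & ~ order_preserving X a.
Proof.
move=> mM; exists (fun x => if x == m then M else m).
  exists [set m]; split; first by exists m.
  - by move=> x y -> ->.
  - by move=> x y /= /eqP/negbTE-> /eqP/negbTE->.
  - by move=> p q -> /= /eqP qm; rewrite eqxx lt_neqAle eq_sym qm min_m max_M.
by move=> /(_ m M I I (min_m M)); rewrite eqxx (gt_eqF mM) leNgt mM.
Qed.

End Homogeneous.
End Chain.

Theorem theorem9 (d : Order.disp_t) (X : orderType d)
  (infX : infinite_set [set: X])
  (denseX : densely_ordered X)
  (isoX : forall C D : set X,
     C !=set0 -> convex C -> ~ has_minimum C -> ~ has_maximum C ->
     D !=set0 -> convex D -> ~ has_minimum D -> ~ has_maximum D ->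
     order_isomorphic C D)
  (minX : has_minimum [set: X])
  (maxX : has_maximum [set: X]) :
  relative_rank_is (orientation_preserving X) (order_preserving X) `I_1.
Proof.
case: minX maxX => m _ minm [M _ maxM].
have {}minm x : m <= x by exact: minm.
have {}maxM x : x <= M by exact: maxM.
have mM : m < M.
  rewrite lt_neqAle minm andbT; apply/eqP => mM; apply: infX.
  apply: (sub_finite_set _ (finite_set1 m)) => x _ /=.
  by apply/le_anti; rewrite minm mM maxM.
have [c opc fact_c] :=
  orientation_preserving_factor denseX isoX _ _ minm maxM mM.
split.
- exists [set c]; split; first by move=> _ ->.
  + apply/seteqP; split.
    * apply: smallest_sub; first exact: orientation_preserving_mul_closed.
      move=> a [|->//]; apply: order_preserving_orientation_preserving.
      by exists m.
    * move=> a /fact_c[b [b' [opb opb' ->]]] G [Gmul subG].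
      apply: (Gmul _ _ _ (subG _ (or_introl opb'))).
      by apply: Gmul; apply: subG; [left|right].
  + by rewrite II1; apply/eq_card1.
- move=> B _ genB.
  have [b Bb] : B !=set0.
    (* With [B] empty, the order-preserving maps, being closed under products, would be all the
       orientation-preserving ones. *)
    apply/set0P/eqP => B0; move: genB; rewrite B0 setU0 => genO.
    have [a opa] :=
      orientation_preserving_not_order_preserving _ _ minm maxM mM.
    apply; move: opa; rewrite -genO; apply: smallest_sub => //.
    exact: order_preserving_mul_closed.
  have bB : [set b] `<=` B by move=> _ ->.
  apply: card_le_trans (subset_card_le bB).
  have /card_eqPle[] // : `I_1 #= [set b] by rewrite II1; apply/eq_card1.
Qed.
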